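(* For a locally quasi-convex abelian group $(G,\tau)$ the following assertions are equivalent: (i) $G$ has a Mackey group topology; (ii) the family $\mathrm{Mac}(G)$ is directed; (iii) $\mathrm{qc}_{\widehat{G}}(K_1\cup K_2)\in\mathrm{Mac}(G)$ for every $K_1,K_2\in\mathrm{Mac}(G)$; (iv) for every $K_1,K_2\in\mathrm{Mac}(G)$, the topology $\mathcal{T}_{K_1}\vee\mathcal{T}_{K_2}$ is compatible with $\tau$; (v) for every $K_1,K_2\in\mathrm{Mac}(G)$, the diagonal group $\Delta=\{(g,g):g\in G\}$ is dually embedded in the product $(G,\mathcal{T}_{K_1})\times(G,\mathcal{T}_{K_2})$. If (i)-(v) are satisfied, the topology $\mu:=\bigvee_{K\in\mathrm{Mac}(G)}\mathcal{T}_K$ is the Mackey group topology of $(G,\tau)$.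
   Context: Abelian groups are written additively. $\mathbb{S}$ is the unit circle group and $\mathbb{S}_+=\{z\in\mathbb{S}:\mathrm{Re}(z)\ge 0\}$. For an abelian topological group $G=(G,\tau)$, $\widehat{G}$ is the group of continuous characters (continuous homomorphisms $G\to\mathbb{S}$), $G^\ast$ is the group of all homomorphisms $G\to\mathbb{S}$, and $(\chi,g):=\chi(g)$. For $A\subseteq G$: $A^{\triangleright}=\{\chi\in\widehat{G}:\chi(A)\subseteq\mathbb{S}_+\}$ and $A^{\blacktriangleright}=\{\chi\in G^\ast:\chi(A)\subseteq\mathbb{S}_+\}$. For $B\subseteq\widehat{G}$: $B^{\triangleleft}=\{g\in G:(\chi,g)\in\mathbb{S}_+ \text{ for all }\chi\in B\}$ and $\mathrm{qc}_{\widehat{G}}(B):=B^{\triangleleft\triangleright}$. For a subset $A$ of an abelian group, $(1)A:=A$ and $(n+1)A:=(n)A+A$. A subset $A$ of an abelian topological group $G$ is quasi-convex if for every $g\in G\setminus A$ there is $\chi\in\widehat{G}$ with $\chi(A)\subseteq\mathbb{S}_+$ and $\chi(g)\notin\mathbb{S}_+$. $G$ (or its topology) is locally quasi-convex if it is Hausdorff and has a neighborhood base at $0$ of quasi-convex sets. $\sigma(\widehat{G},G)$ is the topology of pointwise convergence on $G$; $\widehat{G}_{\sigma^\ast}:=(\widehat{G},\sigma(\widehat{G},G))$, whose continuous characters are exactly the evaluations at elements of $G$ (so $K\subseteq\widehat{G}_{\sigma^\ast}$ is quasi-convex iff $K=K^{\triangleleft\triangleright}$). $\mathrm{Mac}(G)$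 is the family of all quasi-convex compact subsets $K$ of $\widehat{G}_{\sigma^\ast}$ such that for every finite $F\subseteq\widehat{G}$ with $0\in F$ and every integer $n\ge1$, the subset $((n)K+F)^{\triangleleft\blacktriangleright}$ of $G^\ast$ is contained in $\widehat{G}$. For a quasi-convex $K\subseteq\widehat{G}_{\sigma^\ast}$, $\mathcal{T}_K$ is the group topology on $G$ having as a base at zero the sets $((n)K+F)^{\triangleleft}$, where $n\ge 1$ and $0\in F\subseteq\widehat{G}$ is finite. Two group topologies $\mu,\nu$ on $G$ are compatible if $\widehat{(G,\mu)}=\widehat{(G,\nu)}$. ''$G$ has a Mackey group topology'' means that among all locally quasi-convex group topologies on $G$ compatible with $\tau$ there is a finest one; this finest topology is the Mackey group topology. A family $\mathcal{A}$ of sets is directed if for all $A_1,A_2\in\mathcal{A}$ there is $A\in\mathcal{A}$ with $A_1\cup A_2\subseteq A$. $\bigvee$ (or $\vee$) denotes the supremum of group topologies, i.e. the coarsest group topology finer than all of them. A subgroup $H$ of an abelian topological group $L$ is dually embedded in $L$ if every continuous character of $H$ (with the subspace topology) extends to a continuous character of $L$. *)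

(* Defs.v *)
From HB Require Import structures.
From mathcomp Require Import all_boot all_order all_algebra.
From mathcomp Require Import complex.
From mathcomp Require Import all_classical all_reals all_analysis.

Set Implicit Arguments.
Unset Strict Implicit.
Unset Printing Implicit Defensive.

Import Order.TTheory GRing.Theory Num.Theory.
Import numFieldNormedType.Exports.

Local Open Scope classical_set_scope.
Local Open Scope ring_scope.

(* The circle group, written additively: [x + y] is the product of complex
   numbers, so that characters are additive maps. *)
Record circle (R : realType) := Circle {
  circle_val :> R[i];
  circle_valP : `|circle_val| == 1 }.

HB.instance Definition _ (R : realType) := [isSub for @circle_val R].
HB.instance Definition _ (R : realType) := [Choice of circle R by <:].

Section circle_group.
Context {R : realType}.
Implicit Types z w : circle R.

Lemma circle_norm z : `|circle_val z| = 1.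
Proof. exact/eqP/circle_valP. Qed.

Lemma circle_neq0 z : circle_val z != 0.
Proof. by rewrite -normr_eq0 circle_norm oner_eq0. Qed.

Lemma circle_one_subproof : `|1 : R[i]| == 1.
Proof. by rewrite normr1. Qed.

Lemma circle_mul_subproof z w : `|circle_val z * circle_val w| == 1.
Proof. by rewrite normrM !circle_norm mul1r. Qed.

Lemma circle_inv_subproof z : `|(circle_val z)^-1| == 1.
Proof. by rewrite normfV circle_norm invr1. Qed.

Definition circle_one := Circle circle_one_subproof.
Definition circle_mul z w := Circle (circle_mul_subproof z w).
Definition circle_inv z := Circle (circle_inv_subproof z).

Lemma circle_mulA : associative circle_mul.
Proof. by move=> x y z; apply: val_inj; rewrite /= mulrA. Qed.

Lemma circle_mulC : commutative circle_mul.
Proof. by move=> x y; apply: val_inj; rewrite /= mulrC. Qed.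

Lemma circle_mul1 : left_id circle_one circle_mul.
Proof. by move=> x; apply: val_inj; rewrite /= mul1r. Qed.

Lemma circle_mulV : left_inverse circle_one circle_inv circle_mul.
Proof. by move=> x; apply: val_inj; rewrite /= mulVf // circle_neq0. Qed.

HB.instance Definition _ := GRing.isZmodule.Build (circle R)
  circle_mulA circle_mulC circle_mul1 circle_mulV.

Lemma circle_val0 : circle_val (0 : circle R) = 1. Proof. by []. Qed.
Lemma circle_valD z w : circle_val (z + w) = circle_val z * circle_val w.
Proof. by []. Qed.
Lemma circle_valN z : circle_val (- z) = (circle_val z)^-1.
Proof. by []. Qed.

End circle_group.

HB.instance Definition _ (R : realType) := Topological.copy (circle R)
  (initial_topology (@circle_val R : circle R -> R[i]^o)).

Section circle_topology.
Context {R : realType}.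

Lemma circle_val_continuous : continuous (@circle_val R : circle R -> R[i]^o).
Proof. exact: initial_continuous. Qed.

Lemma continuous_circle (T : topologicalType) (f : T -> circle R) :
  continuous (fun x => circle_val (f x) : R[i]^o) -> continuous f.
Proof. exact: continuous_comp_initial. Qed.

Lemma circle_add_continuous :
  continuous (fun x : circle R * circle R => x.1 + x.2).
Proof.
apply: continuous_circle => x.
apply: (@cvgM R[i] _ (nbhs x) _ (fun x => circle_val x.1 : R[i]^o)
  (fun x => circle_val x.2 : R[i]^o)).
  apply: (cvg_comp fst (@circle_val R : circle R -> R[i]^o) cvg_fst).
  exact: circle_val_continuous.
apply: (cvg_comp snd (@circle_val R : circle R -> R[i]^o) cvg_snd).
exact: circle_val_continuous.
Qed.

Lemma circle_opp_continuous : continuous (-%R : circle R -> circle R).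
Proof.
apply: continuous_circle => x.
rewrite /continuous_at.
apply: (@cvgV R[i] _ (nbhs x) _ (@circle_val R : circle R -> R[i]^o)).
  exact: circle_neq0.
exact: circle_val_continuous.
Qed.

HB.instance Definition _ :=
  PreTopologicalNmodule_isTopologicalNmodule.Build (circle R)
    circle_add_continuous.
HB.instance Definition _ :=
  TopologicalNmodule_isTopologicalZmodule.Build (circle R)
    circle_opp_continuous.

End circle_topology.

Definition circle_pos (R : realType) : set (circle R) :=
  [set z | 0 <= complex.Re (circle_val z)].
Arguments circle_pos : clear implicits.

(* Topologies on a fixed carrier are elements of the class [Topological G];
   several of them have to be compared on the same group. *)
Notation space t := (Topological.Pack t).

Section topologies.
Context {G : zmodType}.
Implicit Types t : Topological G.

Definition group_topology t :=
  continuous (fun x : space t * space t => x.1 + x.2 : space t) /\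
  continuous (fun x : space t => - x : space t).

Definition finer t1 t2 :=
  forall A : set G, @open (space t2) A -> @open (space t1) A.

Definition sup_top (I : Type) (t : I -> Topological G) : Topological G :=
  Topological.class (sup_topology t).

Definition join_top t1 t2 := sup_top (fun b : bool => if b then t1 else t2).

Lemma finer_sup_top (I : Type) (t : I -> Topological G) i :
  finer (sup_top t) (t i).
Proof.
move=> A; rewrite openE => Ao; rewrite openE => x /Ao.
have := (@cvg_sup G I t (nbhs (x : space (sup_top t))) x _).1.
by move=> /(_ _ (fun=> id)); apply; exact: nbhs_filter.
Qed.

Lemma sup_top_coarsest (I : Type) (t : I -> Topological G) nu :
  (forall i, finer nu (t i)) -> finer nu (sup_top t).
Proof.
move=> fin A; rewrite openE => Ao; rewrite openE => x /Ao.
apply: ((@cvg_sup G I t (nbhs (x : space nu)) x _).2 _ A) => i B.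
rewrite nbhsE => -[C [/fin Co Cx] CB].
by rewrite /interior (nbhsE (x : space nu)); exists C.
Qed.

Lemma sup_top_group (I : Type) (t : I -> Topological G) :
  (forall i, group_topology (t i)) -> group_topology (sup_top t).
Proof.
move=> tg; have id_cont i : continuous (id : space (sup_top t) -> space (t i)).
  by apply/continuousP => A; exact: finer_sup_top.
split=> x.
  apply: (iffRL (@cvg_sup G I t _ _ (@fmap_filter _ _
    (fun y : space (sup_top t) * space (sup_top t) => y.1 + y.2) _
    (nbhs_filter x)))) => i.
  have [addc _] := tg i.
  have pid : (y.1 : space (t i), y.2 : space (t i))
      @[y --> (x : space (sup_top t) * space (sup_top t))]
      --> (x : space (t i) * space (t i)).
    case: x => a b; apply: cvg_pair.
      by move=> A /(id_cont i a); exact: (@cvg_fst _ _ _ _ (nbhs_filter b)).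
    by move=> A /(id_cont i b); exact: (@cvg_snd _ _ _ _ (nbhs_filter a)).
  exact: (cvg_comp _ _ pid (addc x)).
apply: (iffRL (@cvg_sup G I t _ _ (@fmap_filter _ _
  (fun y : space (sup_top t) => - y) _ (nbhs_filter x)))) => i.
have [_ oppc] := tg i; exact: (cvg_comp _ _ (id_cont i x) (oppc x)).
Qed.

Definition prod_top t1 t2 : Topological (G * G)%type :=
  Topological.class (space t1 * space t2)%type.

End topologies.

Section characters.
Variables (R : realType) (G : zmodType).

Definition hom_pred : {pred G -> circle R} :=
  fun f => `[< nmod_morphism f >].

Record hom := Hom { hom_fun :> G -> circle R; homP : hom_fun \in hom_pred }.

HB.instance Definition _ := [isSub for hom_fun].
HB.instance Definition _ := [Choice of hom by <:].

Lemma hom_zmod_closed : zmod_closed hom_pred.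
Proof.
split; first by apply/asboolP; split=> // x y; rewrite addr0.
move=> f g /asboolP[f0 fD] /asboolP[g0 gD]; apply/asboolP.
split; first by transitivity (f 0 - g 0) => //; rewrite f0 g0 subr0.
by move=> x y; transitivity (f (x + y) - g (x + y)) => //;
  rewrite fD gD opprD addrACA.
Qed.

HB.instance Definition _ :=
  GRing.isZmodClosed.Build (G -> circle R) hom_pred hom_zmod_closed.
HB.instance Definition _ := [SubChoice_isSubZmodule of hom by <:].

Lemma hom_is_additive (f : hom) : nmod_morphism f.
Proof. exact/asboolP/homP. Qed.

HB.instance Definition _ (f : hom) :=
  GRing.isNmodMorphism.Build G (circle R) (hom_fun f) (hom_is_additive f).

End characters.

Section dual_group.
Variables (R : realType) (G : zmodType) (t : Topological G).

Definition continuous_char : set (hom R G) :=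
  [set f | continuous (f : space t -> circle R)].

Definition continuous_char_pred : {pred hom R G} :=
  fun f => `[< continuous_char f >].

Record dual := Dual {
  dual_hom :> hom R G; dualP : dual_hom \in continuous_char_pred }.

HB.instance Definition _ := [isSub for dual_hom].
HB.instance Definition _ := [Choice of dual by <:].

Lemma continuous_char_zmod_closed : zmod_closed continuous_char_pred.
Proof.
split; first by apply/asboolP => x; exact: cvg_cst.
move=> f g /asboolP fc /asboolP gc; apply/asboolP => x.
apply: (@continuous2_cvg (space t) _ _ _ (nbhs x) _ f g
  (fun a b : circle R => a - b)); [|exact: fc|exact: gc].
exact: (@tvs.sub_continuous (circle R) (f x, g x)).
Qed.

HB.instance Definition _ := GRing.isZmodClosed.Build (hom R G)
  continuous_char_pred continuous_char_zmod_closed.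
HB.instance Definition _ := [SubChoice_isSubZmodule of dual by <:].

Lemma dual_continuous (f : dual) : continuous (f : space t -> circle R).
Proof. exact/asboolP/dualP. Qed.

Definition sigma_dual : Topological dual :=
  Topological.class (initial_topology
    (fun f : dual => (f : G -> circle R) : {ptws G -> circle R})).

Definition polar (A : set G) : set dual :=
  [set f | f @` A `<=` circle_pos R].

Definition alg_polar (A : set G) : set (hom R G) :=
  [set f | f @` A `<=` circle_pos R].

Definition prepolar (B : set dual) : set G :=
  [set g | forall f, B f -> circle_pos R (f g)].

Definition qc_hull (B : set dual) : set dual := polar (prepolar B).

Definition quasi_convex (A : set G) :=
  forall g, ~ A g -> exists2 f : dual, polar A f & ~ circle_pos R (f g).

Definition locally_quasi_convex : Prop :=
  hausdorff_space (space t) /\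
  forall U, nbhs (0 : space t) U ->
    exists V, [/\ quasi_convex V, nbhs (0 : space t) V & V `<=` U].

End dual_group.

Arguments continuous_char R {G} t.
Arguments polar R {G} t A.
Arguments alg_polar R {G} A.

Definition compatible (R : realType) (G : zmodType) (t1 t2 : Topological G) :=
  continuous_char R t1 = continuous_char R t2.

Section sumset.
Context {G : zmodType}.
Implicit Types A B : set G.

Definition sumset A B : set G := [set a + b | a in A & b in B].

(* $(n)A$ is only meant for $n \ge 1$ *)
Definition nsumset n A : set G := iter n.-1 (sumset^~ A) A.

End sumset.

Section circle_pos_theory.
Context {R : realType}.
Implicit Types z w : circle R.

Lemma circle_pos0 : circle_pos R 0.
Proof. by rewrite /circle_pos /=. Qed.

Lemma circle_posN z : circle_pos R z -> circle_pos R (- z).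
Proof.
rewrite /circle_pos /=; case: z => -[a b] /= _ a0.
by rewrite mulr_ge0 // invr_ge0 addr_ge0 ?sqr_ge0.
Qed.

Lemma circle_posD z w : circle_pos R z -> circle_pos R (z + z) ->
  circle_pos R w -> circle_pos R (w + w) -> circle_pos R (z + w).
Proof.
rewrite /circle_pos /=; case: z => -[a b] /= _; case: w => -[c d] /= _.
rewrite -!expr2 !subr_ge0 => a0 ba c0 dc.
have {}ba : `|b| <= a by rewrite -(ler_sqr (normr_ge0 b)) ?real_normK ?num_real.
have {}dc : `|d| <= c by rewrite -(ler_sqr (normr_ge0 d)) ?real_normK ?num_real.
by rewrite (le_trans (ler_norm _)) // normrM ler_pM.
Qed.

End circle_pos_theory.

Section sumset_theory.
Context {G : zmodType}.
Implicit Types A B : set G.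

Lemma sumsetS A A' B B' : A `<=` A' -> B `<=` B' -> sumset A B `<=` sumset A' B'.
Proof. by move=> AA BB _ [a /AA Aa [b /BB Bb <-]]; exists a => //; exists b. Qed.

Lemma nsumset_le A m n : A 0 -> (0 < m <= n)%N -> nsumset m A `<=` nsumset n A.
Proof.
move=> A0; case: m => // m; case: n => // n /= mn.
rewrite -(subnKC mn) {mn} /nsumset subSS; elim: (n - m)%N => [|k IH].
  by rewrite addn0.
move=> x /IH xk; rewrite addnS /=; exists x => //; exists 0 => //.
exact: addr0.
Qed.

Lemma nsumsetD A m n x y : (0 < m)%N -> (0 < n)%N ->
  nsumset m A x -> nsumset n A y -> nsumset (m + n) A (x + y).
Proof.
case: m n => // m [|n] // _ _; rewrite /nsumset addnS /= => Ax.
elim: n y => [|n IH] y; first by rewrite addn0 => Ay; exists x => //; exists y.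
move=> [a /IH Aa [b Ab <-]]; rewrite addnS; exists (x + a) => //.
by exists b => //; rewrite addrA.
Qed.

End sumset_theory.

Lemma quasi_convex0 (R : realType) (G : zmodType) (t : Topological G)
  (A : set G) : quasi_convex R t A -> A 0.
Proof.
move=> qcA; apply: contrapT => /qcA[f _]; rewrite raddf0; apply.
exact: circle_pos0.
Qed.

Section mac_topology.
Variables (R : realType) (G : zmodType) (tau : Topological G).
Local Notation Gd := (dual R tau).

Definition mac_base (K : set Gd) (V : set G) :=
  exists n (F : set Gd), [/\ (0 < n)%N, finite_set F, F 0 &
    V = prepolar (sumset (nsumset n K) F)].

Lemma mac_base0 K V : mac_base K V -> V 0.
Proof.
by move=> [n [F [_ _ _ ->]]] f _; rewrite raddf0; exact: circle_pos0.
Qed.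

Lemma mac_baseN K V x : mac_base K V -> V x -> V (- x).
Proof.
move=> [n [F [_ _ _ ->]]] Vx f /Vx; rewrite raddfN; exact: circle_posN.
Qed.

Lemma mac_baseT K : exists V, mac_base K V.
Proof.
by exists (prepolar (sumset (nsumset 1 K) [set 0])), 1%N, [set 0];
  split => //; exact: finite_set1.
Qed.

Section zero_mem.
Variables (K : set Gd) (K0 : K 0).

Let nsumset0 n : (0 < n)%N -> nsumset n K 0.
Proof. by move=> n0; apply: (@nsumset_le _ K 1 n). Qed.

Lemma mac_baseI V W : mac_base K V -> mac_base K W ->
  exists2 U, mac_base K U & U `<=` V `&` W.
Proof.
move=> [m [F [m0 finF F0 ->]]] [n [H [n0 finH H0 ->]]].
exists (prepolar (sumset (nsumset (maxn m n) K) (F `|` H))).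
  exists (maxn m n), (F `|` H); split; rewrite ?leq_max ?m0 //; last by left.
  by rewrite finite_setU.
move=> g Ug; split=> f Ff; apply: Ug; apply: sumsetS Ff.
- by apply: nsumset_le; rewrite // m0 leq_maxl.
- by move=> x; left.
- by apply: nsumset_le; rewrite // n0 leq_maxr.
- by move=> x; right.
Qed.

Lemma mac_base_half V : mac_base K V ->
  exists2 U, mac_base K U & forall x y, U x -> U y -> V (x + y).
Proof.
move=> [n [F [n0 finF F0 ->]]].
exists (prepolar (sumset (nsumset (n + n) K) (sumset F F))).
  exists (n + n)%N, (sumset F F); split => //; first by rewrite addn_gt0 n0.
    exact: finite_image2.
  by exists 0 => //; exists 0 => //; rewrite addr0.
move=> x y Ux Uy _ [k kK [f Ff <-]]; rewrite raddfD.
have kf1 : sumset (nsumset (n + n) K) (sumset F F) (k + f).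
  exists k; first by apply: nsumset_le kK; rewrite // n0 leq_addr.
  by exists f => //; exists f => //; exists 0 => //; rewrite addr0.
have kf2 : sumset (nsumset (n + n) K) (sumset F F) ((k + f) + (k + f)).
  exists (k + k); first exact: nsumsetD.
  by exists (f + f); rewrite 1?addrACA//; exists f => //; exists f.
by apply: circle_posD; [exact: Ux kf1|exact: Ux kf2|exact: Uy kf1|exact: Uy kf2].
Qed.

End zero_mem.

Section mac_space.
Variables (K : set Gd) (qcK : quasi_convex R (sigma_dual R tau) K).

(* [qcK] is only used for [K 0], without which the sets in [mac_base K] need
   not be a neighborhood base at [0]. *)
Definition mac_space of quasi_convex R (sigma_dual R tau) K : Type := G.
Local Notation T := (mac_space qcK).

HB.instance Definition _ := GRing.Zmodule.on T.

Definition mac_nbhs (x : T) : set_system T :=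
  [set A | exists2 V, mac_base K V & forall g, V g -> A (x + g)].

HB.instance Definition _ := hasNbhs.Build T mac_nbhs.

Let K0 : K 0. Proof. exact: quasi_convex0 qcK. Qed.

Lemma mac_nbhs_filter (x : T) : ProperFilter (nbhs x).
Proof.
split; first by move=> [V /mac_base0 V0] /(_ _ V0).
split.
- by have [V KV] := mac_baseT K; exists V.
- move=> A B [V KV VA] [W KW WB].
  have [U KU UVW] := mac_baseI K0 KV KW; exists U => // g /UVW[Vg Wg].
  by split; [exact: VA|exact: WB].
- by move=> A B AB [V KV VA]; exists V => // g /VA/AB.
Qed.

Lemma mac_nbhs_singleton (x : T) (A : set T) : nbhs x A -> A x.
Proof. by move=> [V /mac_base0 V0] /(_ _ V0); rewrite addr0. Qed.

Lemma mac_nbhs_nbhs (x : T) (A : set T) : nbhs x A -> nbhs x (nbhs^~ A).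
Proof.
move=> [V KV VA]; have [U KU UV] := mac_base_half K0 KV.
by exists U => // g Ug; exists U => // h Uh; rewrite -addrA; apply/VA/UV.
Qed.

HB.instance Definition _ := Nbhs_isNbhsTopological.Build T
  mac_nbhs_filter mac_nbhs_singleton mac_nbhs_nbhs.

Definition mac_top : Topological G := Topological.class T.

Lemma nbhs0_mac_top (A : set G) :
  nbhs (0 : space mac_top) A <-> exists2 V, mac_base K V & V `<=` A.
Proof.
by split=> -[V KV VA]; exists V => // g Vg; have := VA _ Vg; rewrite add0r.
Qed.

Lemma mac_top_group : group_topology mac_top.
Proof.
split=> x A [V KV VA].
  have [U KU UV] := mac_base_half K0 KV.
  exists ([set y | exists2 g, U g & y = x.1 + g],
          [set y | exists2 g, U g & y = x.2 + g]).
    by split; exists U => // g Ug; exists g.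
  move=> [a b] /= [[g Ug ->] [h Uh ->]]; rewrite addrACA; exact/VA/UV.
exists V => // g Vg; rewrite /= opprD; exact/VA/(mac_baseN KV).
Qed.

End mac_space.

End mac_topology.

Section Mac.
Variables (R : realType) (G : zmodType) (tau : Topological G).

Definition Mac : set (set (dual R tau)) :=
  [set K | [/\ quasi_convex R (sigma_dual R tau) K,
     compact (K : set (space (sigma_dual R tau))) &
     forall (F : set (dual R tau)) n, finite_set F -> F 0 -> (0 < n)%N ->
       alg_polar R (prepolar (sumset (nsumset n K) F)) `<=`
       continuous_char R tau]].

Lemma Mac_quasi_convex K : Mac K -> quasi_convex R (sigma_dual R tau) K.
Proof. by case. Qed.

Definition Mac_top K (macK : Mac K) : Topological G :=
  mac_top (Mac_quasi_convex macK).

End Mac.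

Section mackey.
Variables (R : realType) (G : zmodType) (tau : Topological G).
Implicit Type mu : Topological G.

Definition admissible mu :=
  [/\ group_topology mu, locally_quasi_convex R mu & compatible R tau mu].

Definition is_mackey mu :=
  admissible mu /\ forall nu, admissible nu -> finer mu nu.

Definition has_mackey := exists mu, is_mackey mu.

Definition directed (T : Type) (F : set (set T)) :=
  forall A B, F A -> F B -> exists2 C, F C & A `|` B `<=` C.

(* A character of [H] is represented by any extension of it to a function on
   [G]: the values of [f] outside [H] play no role in the hypotheses. *)
Definition dually_embedded (H : set G) :=
  forall f : G -> circle R,
    {in H &, {morph f : x y / x + y}} ->
    {within (H : set (space tau)), continuous (f : space tau -> circle R)} ->
    exists chi : dual R tau, {in H, chi =1 f}.

End mackey.

Definition diagonal_group (G : zmodType) : set (G * G) :=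
  [set x | exists g, x = (g, g)].
Arguments diagonal_group : clear implicits.

(* Main.v *)
Require Import Defs.
From HB Require Import structures.
From mathcomp Require Import all_boot all_order all_algebra.
From mathcomp Require Import complex lra.
From mathcomp Require Import all_classical all_reals all_analysis.

Set Implicit Arguments.
Unset Strict Implicit.
Unset Printing Implicit Defensive.

Import Order.TTheory GRing.Theory Num.Theory.
Import numFieldNormedType.Exports.
Import Defs.

Local Open Scope classical_set_scope.
Local Open Scope ring_scope.

(** The proof rests on a dictionary between [Mac G] and the admissible
    topologies, that is, the compatible locally quasi-convex group topologies.

    From [K] in [Mac G] to topologies: [T_K] is admissible
    ([Mac_top_admissible]). A homomorphism that is continuous for [T_K] sends
    some basic neighborhood, the prepolar of [(n)K + F], into the right
    half-circle, hence belongs to the dual of [G] by the very definition of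
    [Mac]; conversely a continuous character [f] is [T_K]-continuous because
    [F] may contain arbitrarily many multiples of [f]. The basic neighborhoods
    are quasi-convex since they are prepolars of sets of [T_K]-continuous
    characters.

    From topologies to [Mac G]: if [mu] is a compatible group topology and [V]
    is any [mu]-neighborhood of [0], then the polar of [V] is in [Mac G]
    ([Mac_polar]). The polar is equicontinuous at [0] for [mu], and so is [(n)K
    + F]; thus the prepolar of the latter is a [mu]-neighborhood of [0], and a
    homomorphism that maps it into the right half-circle is continuous.
    Compactness is the Alaoglu argument: the polar is closed in the product of
    copies of the circle. If [V] is moreover quasi-convex, it is the prepolar
    of its polar [K], so it is a neighborhood of [0] for [T_K]; hence the
    supremum of all the [T_K] is finer than every admissible topology
    ([mackey_top_finest]).

    Both passages use one fact on the circle ([circle_pos_small]): a point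
    whose first dyadic multiples all stay in the right half-circle is close to
    [0].

    The equivalences follow. If [mu] is the Mackey topology, or if [mu] is the
    join of [T_K1] and [T_K2] and is compatible, then the prepolar of the union
    of [K1] and [K2] is a [mu]-neighborhood of [0], so the hull of the union is
    in [Mac G], which is therefore directed. If some [K] in [Mac G] contains
    [K1] and [K2], the same argument with [T_K] puts their hull in [Mac G], and
    the topology of the hull is finer than the join, so the join is compatible.
    If [Mac G] is directed, a neighborhood of [0] in the supremum of the [T_K]
    is a neighborhood of [0] in a single [T_K], so the supremum is compatible
    and is the Mackey topology. Finally, the continuous characters of the
    diagonal in the product of [T_K1] and [T_K2] are those of the join, and the
    characters of the product are the sums of a [T_K1]-continuous and a
    [T_K2]-continuous one. *)

(** * Two facts on general topological spaces *)

Lemma compact_initial (S : choiceType) (T : topologicalType) (f : S -> T)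
    (K : set S) : compact (f @` K) -> compact (K : set (initial_topology f)).
Proof.
move=> fK F FF FK; have fFK : (f @ F) (f @` K).
  exact: (filterS (@preimage_image _ _ f K) FK).
have [p []] := fK (f @ F) (fmap_proper_filter f FF) fFK.
move=> [k Kk fkp] clk; subst p.
exists k; split=> // A V FA [_ [[B Bo <-] Bfk BV]].
have fFA : (f @ F) (f @` A).
  exact: (filterS (@preimage_image _ _ f A) FA).
have [_ [[a Aa <-] Ba]] := clk _ _ fFA (open_nbhs_nbhs (conj Bo Bfk)).
by exists a; split=> //; exact: BV.
Qed.

Lemma separated_hausdorff (T U : topologicalType) : hausdorff_space U ->
  (forall x y : T, x <> y -> exists2 f : T -> U, continuous f & f x <> f y) ->
  hausdorff_space T.
Proof.
move=> hU sep x y clxy; apply: contrapT => /sep[f fc]; apply; apply: hU.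
move=> A B /fc/= fA /fc/= fB; have [z [Az Bz]] := clxy _ _ fA fB.
by exists (f z).
Qed.

(** * The circle group *)

Section circle_facts.
Context {R : realType}.
Implicit Types z w : circle R.

Local Notation re z := (complex.Re (circle_val z)).

Lemma circle_normE z : re z ^+ 2 + complex.Im (circle_val z) ^+ 2 = 1.
Proof.
have := circle_norm z; case: z => -[a b] zP /=.
rewrite normc_def /= => -[] /(congr1 (fun x => x ^+ 2)).
by rewrite sqr_sqrtr ?expr1n // addr_ge0 ?sqr_ge0.
Qed.

Lemma circle_re_le1 z : re z <= 1.
Proof.
have := circle_normE z; case: z => -[a b] /= _ ab.
have := sqr_ge0 b; nra.
Qed.

Lemma circle_re_double z : re (z *+ 2) = 2 * re z ^+ 2 - 1.
Proof.
have := circle_normE z; rewrite mulr2n; case: z => -[a b] /= _ ab; lra.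
Qed.

(** The sets [{z | 1 - Re z < e}] form a neighborhood base at [0], because
    [`|1 - z| ^ 2 = 2 (1 - Re z)] on the circle. *)
Lemma circle_nbhs0P (U : set (circle R)) :
  nbhs 0 U <-> exists2 e : R, 0 < e & forall z, 1 - re z < e -> U z.
Proof.
split.
  case=> _ [[B Bo <-] B1 BU].
  have : nbhs (1 : R[i]^o) B by apply: open_nbhs_nbhs.
  move=> /nbhs_ballP[ [r s] /=]; rewrite ltcE /= => /andP[/eqP s0 r0] rB.
  exists (r ^+ 2 / 2); first by rewrite divr_gt0 ?exprn_gt0.
  move=> z zr; apply/BU/rB; rewrite /ball /= ltcE /= -s0 eqxx /=.
  have := circle_normE z; move: zr; case: z => -[a b] /= _ ar ab.
  rewrite -[ltRHS](ger0_norm (ltW r0)) -sqrtr_sqr ltr_sqrt ?exprn_gt0 //.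
  nra.
move=> [e e0 eU].
have : nbhs (circle_val (0 : circle R) : R[i]^o) (ball (1 : R[i]^o) e%:C%C).
  by apply: nbhsx_ballx; rewrite ltcE /= eqxx.
move=> /(@circle_val_continuous R 0) ball1.
apply: (@filterS _ _ (nbhs_filter (0 : circle R)) _ _ _ ball1) => z /=.
rewrite /ball /= ltcE /= => /andP[_] ze; apply: eU; apply: le_lt_trans ze.
apply: le_trans (ler_norm _) _; case: z => -[a b] /= _.
by rewrite -sqrtr_sqr ler_wsqrtr // lerDl sqr_ge0.
Qed.

Lemma nbhs_circle_pos : nbhs (0 : circle R) (circle_pos R).
Proof.
by apply/circle_nbhs0P; exists 1 => // z; rewrite /circle_pos /=; lra.
Qed.

(** If the multiples [2 ^ j * z] with [j <= m] all lie in the right half-circle,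
    then [1 - Re z] is at most [2 ^- m]: by the double-angle formula
    [1 - Re (2 z) = 2 (1 - Re z) (1 + Re z)], each doubling multiplies [1 - Re]
    by at least [2] as long as [Re] is nonnegative. *)
Lemma circle_pos_small (U : set (circle R)) : nbhs 0 U ->
  exists m : nat, forall z,
    (forall j, (j <= m)%N -> circle_pos R (z *+ 2 ^ j)) -> U z.
Proof.
move=> /circle_nbhs0P[e e0 eU].
have [m me] : exists m : nat, (2 ^- m) < e.
  have [m _ me] := near_infty_natSinv_expn_lt (PosNum e0).
  by exists m; rewrite -div1r; exact: me (leqnn m).
exists m => z zm; apply: eU; apply: le_lt_trans me.
have double j : (j <= m)%N -> 2 ^+ j * (1 - re z) <= 1 - re (z *+ 2 ^ j).
  elim: j => [|j IH] jm; first by rewrite mul1r.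
  have := IH (ltnW jm); have := zm j (ltnW jm).
  rewrite expnSr mulrnA circle_re_double /circle_pos /= exprS.
  set c := re _ => c0; have c1 : c <= 1 by exact: circle_re_le1.
  rewrite -mulrA => cj; nra.
have := double m (leqnn m); have := zm m (leqnn m).
rewrite /circle_pos /= => ? ?.
rewrite -[leRHS]mul1r ler_pdivlMr ?exprn_gt0 // mulrC; lra.
Qed.

Lemma circle_hausdorff : hausdorff_space (circle R).
Proof.
apply: (@separated_hausdorff _ (R[i]^o : topologicalType)).
  exact: norm_hausdorff.
move=> z w zw; exists (@circle_val R); first exact: circle_val_continuous.
by move=> /val_inj.
Qed.

Lemma complex_pair_continuous :
  continuous (fun x : R * R => (x.1 +i* x.2)%C : R[i]^o).
Proof.
move=> [a b]; apply/cvgrPdist_lt => -[r s]; rewrite ltcE /=.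
move=> /andP[/eqP -> r0]; have r20 : 0 < r / 2 by rewrite divr_gt0.
exists (ball a (r / 2), ball b (r / 2)); first by split; exact: nbhsx_ballx.
move=> [c d] [/=]; rewrite /ball /= => ac bd.
rewrite ltcE /= eqxx /= -[ltRHS](ger0_norm (ltW r0)) -sqrtr_sqr.
rewrite ltr_sqrt ?exprn_gt0 //.
by move: ac bd; rewrite !ltr_norml => /andP[? ?] /andP[? ?]; nra.
Qed.

Lemma circle_compact : compact [set: circle R].
Proof.
apply: compact_initial.
pose square := `[-1, 1]%classic `*` `[-1, 1]%classic : set (R * R).
have sqc : compact square by apply: compact_setX; exact: segment_compact.
have imc := continuous_compact
  (continuous_subspaceT complex_pair_continuous) sqc.
apply: (subclosed_compact _ imc); last first.
  move=> _ [z _ <-]; have := circle_normE z; case: z => -[a b] /= _ ab.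
  by exists (a, b) => //; split; rewrite /= in_itv /=; nra.
have -> : @circle_val R @` [set: circle R] =
    (fun z : R[i]^o => `|z|) @^-1` [set 1].
  rewrite eqEsubset; split=> [_ [z _ <-]|z /eqP z1]; first exact: circle_norm.
  by exists (Circle z1).
apply: closed_comp => [z _|]; first exact: norm_continuous.
apply: (@accessible_closed_set1 (R[i]^o : topologicalType)).
by apply: hausdorff_accessible; exact: norm_hausdorff.
Qed.

Lemma complex_Re_continuous :
  continuous (fun z : R[i]^o => complex.Re z : R).
Proof.
move=> z; apply/(@cvgrPdist_lt _ _ _ _ (nbhs_filter (z : R[i]^o))) => e e0.
have ze : nbhs (z : R[i]^o) (ball (z : R[i]^o) e%:C%C).
  by apply: nbhsx_ballx; rewrite ltcE /= eqxx.
apply: (@filterS _ _ (nbhs_filter (z : R[i]^o)) _ _ _ ze) => w.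
rewrite /ball /= ltcE /= => /andP[_]; apply: le_lt_trans.
case: z {ze} => a b; case: w => c d /=.
by rewrite -sqrtr_sqr ler_wsqrtr // lerDl sqr_ge0.
Qed.

Lemma closed_circle_pos : closed (circle_pos R).
Proof.
have -> : circle_pos R =
    (fun z => complex.Re (circle_val z)) @^-1` [set x : R | 0 <= x] by [].
apply: closed_comp => [z _|]; last exact: closed_ge.
apply: (continuous_comp (f := @circle_val R : circle R -> R[i]^o)
  (g := fun z : R[i]^o => complex.Re z)).
  exact: circle_val_continuous.
exact: complex_Re_continuous.
Qed.

End circle_facts.

(** * Neighborhoods in a topological group *)

Section group_nbhs.
Variables (G : zmodType) (t : Topological G) (tg : group_topology t).

Lemma group_translate_continuous (x : G) :
  continuous (fun g : space t => x + g : space t).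
Proof.
move=> g; have := tg.1 ((x : space t), (g : space t)).
apply: cvg_trans => A [[B C] [/= Bx Cg] BCA].
apply: (@filterS _ _ (nbhs_filter (g : space t)) _ _ _ Cg) => h Ch.
by apply: (BCA (x, h)); split => //; exact: (@nbhs_singleton (space t) _ _ Bx).
Qed.

Lemma nbhs_group0 (x : G) (A : set G) :
  nbhs (x : space t) A <-> nbhs (0 : space t) [set g | A (x + g)].
Proof.
split=> [xA|A0].
  by apply: (@group_translate_continuous x (0 : space t)); rewrite addr0.
have := @group_translate_continuous (- x) (x : space t) [set g | A (x + g)].
rewrite addNr => /(_ A0).
apply: (@filterS _ _ (nbhs_filter (x : space t))) => g /=.
by rewrite addrA subrr add0r.
Qed.

Lemma nbhs_group0D (A : set G) : nbhs (0 : space t) A ->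
  exists2 U, nbhs (0 : space t) U & forall x y, U x -> U y -> A (x + y).
Proof.
move=> A0; have := tg.1 ((0 : space t), (0 : space t)) A.
rewrite addr0 => /(_ A0)[[B C] [/= B0 C0] BCA].
exists (B `&` C); first exact: filterI.
by move=> x y [Bx _] [_ Cy]; exact: (BCA (x, y)).
Qed.

Lemma nbhs_group0_dyadic (m : nat) (V : set G) : nbhs (0 : space t) V ->
  nbhs (0 : space t) [set g | forall j, (j <= m)%N -> V (g *+ 2 ^ j)].
Proof.
move=> V0; elim: m => [|m IH].
  apply: (@filterS _ _ (nbhs_filter (0 : space t)) _ _ _ V0) => g Vg j.
  by rewrite leqn0 => /eqP ->.
have [U U0 UA] := nbhs_group0D IH.
apply: (@filterS _ _ (nbhs_filter (0 : space t)) _ _ _ (filterI V0 U0)).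
move=> g [Vg Ug] [_|j jm]; first by rewrite mulr1n.
by rewrite expnS mulrnA mulr2n; exact: UA.
Qed.

End group_nbhs.

Lemma circle_group_topology (R : realType) :
  group_topology (Topological.class (circle R)).
Proof.
by split; [exact: circle_add_continuous|exact: circle_opp_continuous].
Qed.

(** * Equicontinuity and continuity of characters *)

Section equicontinuity.
Variables (R : realType) (G : zmodType) (t : Topological G).

(** Equicontinuity at [0] of the family of homomorphisms [ev f] with [f] in [B].
    The map [ev] lets [B] be a set of homomorphisms as well as a set of
    characters that are continuous for a topology other than [t]. *)
Definition equicontinuous0 (T : Type) (ev : T -> hom R G) (B : set T) :=
  forall U : set (circle R), nbhs (0 : circle R) U ->
    nbhs (0 : space t) [set g | forall f, B f -> U (ev f g)].

Hypothesis tg : group_topology t.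

(** If [V] is mapped into the right half-circle, the [g] whose first dyadic
    multiples lie in [V] are mapped close to [0]. *)
Lemma equicontinuous0_pos (T : Type) (ev : T -> hom R G) (B : set T)
    (V : set G) : nbhs (0 : space t) V ->
  (forall f g, B f -> V g -> circle_pos R (ev f g)) -> equicontinuous0 ev B.
Proof.
move=> V0 BV U /circle_pos_small[m mU]; have := nbhs_group0_dyadic tg m V0.
apply: (@filterS _ _ (nbhs_filter (0 : space t))) => g gV f Bf.
by apply: mU => j jm; rewrite -raddfMn; apply: BV => //; exact: gV.
Qed.

Lemma continuous_char0 (f : hom R G) :
  (forall U : set (circle R), nbhs (0 : circle R) U ->
     nbhs (0 : space t) [set g | U (f g)]) -> continuous_char R t f.
Proof.
move=> f0 x A /= fxA; apply/(nbhs_group0 tg).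
have /f0 := (nbhs_group0 (@circle_group_topology R) (f x) A).1 fxA.
apply: (@filterS _ _ (nbhs_filter (0 : space t))) => g /=.
by rewrite raddfD.
Qed.

(** A homomorphism that maps a neighborhood of [0] into the right half-circle is
    continuous. *)
Lemma continuous_char_pos (f : hom R G) (V : set G) : nbhs (0 : space t) V ->
  V `<=` [set g | circle_pos R (f g)] -> continuous_char R t f.
Proof.
move=> V0 Vf; apply: continuous_char0 => U U0.
have := @equicontinuous0_pos _ id [set f] V V0.
have fV : forall h g, [set f] h -> V g -> circle_pos R (h g).
  by move=> _ g -> /Vf.
move=> /(_ fV _ U0); apply: (@filterS _ _ (nbhs_filter (0 : space t))) => g.
exact.
Qed.

Lemma continuous_char_nbhs0 (f : hom R G) (U : set (circle R)) :
  continuous_char R t f -> nbhs (0 : circle R) U ->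
  nbhs (0 : space t) [set g | U (f g)].
Proof. by move=> fc U0; apply: (fc (0 : space t)); rewrite raddf0. Qed.

Variable tau : Topological G.
Local Notation Gd := (dual R tau).
Local Notation equi := (@equicontinuous0 Gd (@dual_hom R G tau)).

Lemma equicontinuous0_finite (F : set Gd) : finite_set F ->
  continuous_char R tau `<=` continuous_char R t -> equi F.
Proof.
move=> finF tt U U0.
have /finite_fsetP[D FD] := finF.
have := @filter_bigI G Gd D (fun f : Gd => [set g | U (f g)])
  (nbhs (0 : space t)) (nbhs_filter (0 : space t)).
rewrite -FD => capD.
apply: (@filterS _ _ (nbhs_filter (0 : space t)) _ _ _ (capD _)).
  by [].
by move=> f fD; apply: continuous_char_nbhs0 U0; exact/tt/dual_continuous.
Qed.

Lemma equicontinuous0_sumset (A B : set Gd) :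
  equi A -> equi B -> equi (sumset A B).
Proof.
move=> eA eB U /(nbhs_group0D (@circle_group_topology R))[W W0 WU].
have AB0 := @filterI _ _ (nbhs_filter (0 : space t)) _ _ (eA W W0) (eB W W0).
apply: (@filterS _ _ (nbhs_filter (0 : space t)) _ _ _ AB0) => g [Ag Bg].
by move=> _ [a Aa [b Bb <-]]; exact: WU (Ag _ Aa) (Bg _ Bb).
Qed.

Lemma equicontinuous0_nsumset n (A : set Gd) :
  equi A -> equi (nsumset n A).
Proof.
move=> eA; rewrite /nsumset; elim: n.-1 => //= k IH.
exact: equicontinuous0_sumset.
Qed.

Lemma equicontinuous0_prepolar (A : set Gd) :
  equi A -> nbhs (0 : space t) (prepolar A).
Proof. by move=> /(_ _ nbhs_circle_pos). Qed.

End equicontinuity.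

(** * Comparison and suprema of topologies; quasi-convex sets *)

Section topologies_and_characters.
Variables (R : realType) (G : zmodType).
Implicit Types t : Topological G.

Lemma dual_lift t (f : hom R G) : continuous_char R t f ->
  exists F : dual R t, dual_hom F = f.
Proof. by move=> fc; exists (Dual (introT (asboolP _) fc)). Qed.

Lemma finer_nbhs t1 t2 (x : G) (A : set G) : finer t1 t2 ->
  nbhs (x : space t2) A -> nbhs (x : space t1) A.
Proof.
move=> t12; rewrite nbhsE => -[B [/t12 Bo Bx] BA].
by rewrite nbhsE; exists B.
Qed.

Lemma finer_nbhs0 t1 t2 :
  group_topology t1 -> group_topology t2 ->
  (forall A, nbhs (0 : space t2) A -> nbhs (0 : space t1) A) -> finer t1 t2.
Proof.
move=> g1 g2 n12 A; rewrite openE => Ao; rewrite openE => x /Ao.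
move=> xA; apply/(nbhs_group0 g1)/n12; exact: (nbhs_group0 g2 x A).1 xA.
Qed.

Lemma finer_continuous_char t1 t2 : finer t1 t2 ->
  continuous_char R t2 `<=` continuous_char R t1.
Proof. by move=> t12 f fc x A /fc; exact: (finer_nbhs t12). Qed.

Lemma finer_hausdorff t1 t2 : finer t1 t2 ->
  hausdorff_space (space t2) -> hausdorff_space (space t1).
Proof.
move=> t12 h x y clxy; apply: h => A B xA yB.
by apply: clxy; exact: (finer_nbhs t12).
Qed.

Lemma quasi_convexS t1 t2 (A : set G) :
  continuous_char R t1 `<=` continuous_char R t2 ->
  quasi_convex R t1 A -> quasi_convex R t2 A.
Proof.
move=> t12 qA g /qA[f fA fg].
have [F Ff] := dual_lift (t12 _ (@dual_continuous _ _ _ f)).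
by exists F; [rewrite /polar /= Ff|rewrite Ff].
Qed.

Lemma quasi_convexI t (A B : set G) :
  quasi_convex R t A -> quasi_convex R t B -> quasi_convex R t (A `&` B).
Proof.
move=> qA qB g; rewrite not_andE => -[/qA|/qB] [f fP fg]; exists f => //.
  by move=> _ [x [Ax _] <-]; apply: fP; exists x.
by move=> _ [x [_ Bx] <-]; apply: fP; exists x.
Qed.

Lemma quasi_convex_prepolar t (B : set (dual R t)) :
  quasi_convex R t (prepolar B).
Proof.
move=> g /existsNP[f /not_implyP[Bf fg]]; exists f => //.
by move=> _ [x xB <-]; exact: xB.
Qed.

Lemma bipolar_quasi_convex t (V : set G) :
  quasi_convex R t V -> prepolar (polar R t V) `<=` V.
Proof.
move=> qV g gP; apply: contrapT => /qV[f fV]; apply; exact: gP.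
Qed.

Lemma prepolarU t (A B : set (dual R t)) :
  prepolar (A `|` B) = prepolar A `&` prepolar B.
Proof.
rewrite eqEsubset; split=> [g gAB|g [gA gB] f [/gA|/gB]//].
by split=> f fA; apply: gAB; [left|right].
Qed.

Lemma subset_qc_hull t (B : set (dual R t)) : B `<=` qc_hull B.
Proof. by move=> f Bf _ [g gB <-]; exact: gB. Qed.

(** The neighborhoods of [0] in the supremum that contain a quasi-convex
    neighborhood form a filter, and this filter converges to [0] for every
    [t i], hence for the supremum. *)
Lemma sup_top_lqc (I : Type) (t : I -> Topological G) (i : I) :
  (forall i, locally_quasi_convex R (t i)) ->
  locally_quasi_convex R (sup_top t).
Proof.
move=> tq; split.
  exact: (finer_hausdorff (@finer_sup_top _ _ t i) (tq i).1).
pose F : set_system G := [set A | exists V, [/\ quasi_convex R (sup_top t) V,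
  nbhs (0 : space (sup_top t)) V & V `<=` A]].
have F0 := nbhs_filter (0 : space (sup_top t)).
have FF : Filter F.
  split.
  - by exists setT; split => //; [move=> g []|exact: (@filterT _ _ F0)].
  - move=> A B [V [qV V0 VA]] [W [qW W0 WB]]; exists (V `&` W); split.
    + exact: quasi_convexI.
    + exact: (@filterI _ _ F0).
    + by move=> x [/VA ? /WB].
  - move=> A B AB [V [qV V0 VA]]; exists V; split => //.
    exact: subset_trans AB.
have := (@cvg_sup G I t F 0 FF).2 _; apply => j A.
move=> /(tq j).2[V [qV V0 VA]]; exists V; split => //.
  apply: quasi_convexS qV; apply: finer_continuous_char.
  exact: finer_sup_top.
exact: finer_nbhs (@finer_sup_top _ _ t j) V0.
Qed.

(** For a directed family, the union of the neighborhood filters of [x] is a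
    filter, to which the universal property of the supremum applies. *)
Lemma sup_top_directed_nbhs (I : Type) (t : I -> Topological G) (i0 : I)
    (x : G) (A : set G) :
  (forall i j, exists k, finer (t k) (t i) /\ finer (t k) (t j)) ->
  nbhs (x : space (sup_top t)) A -> exists i, nbhs (x : space (t i)) A.
Proof.
move=> dir.
pose F : set_system G := [set A : set G | exists i, nbhs (x : space (t i)) A].
have FF : Filter F.
  split.
  - by exists i0; exact: (@filterT _ _ (nbhs_filter (x : space (t i0)))).
  - move=> B C [i iB] [j jC]; have [k [ki kj]] := dir i j; exists k.
    apply: (@filterI _ _ (nbhs_filter (x : space (t k)))).
      exact: finer_nbhs ki iB.
    exact: finer_nbhs kj jC.
  - move=> B C BC [i iB]; exists i.
    exact: (@filterS _ _ (nbhs_filter (x : space (t i))) _ _ BC).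
by apply: ((@cvg_sup G I t F x FF).2 _) => j B; exists j.
Qed.

Lemma finer_joinl t1 t2 : finer (join_top t1 t2) t1.
Proof.
exact: (@finer_sup_top _ _ (fun b : bool => if b then t1 else t2) true).
Qed.

Lemma finer_joinr t1 t2 : finer (join_top t1 t2) t2.
Proof.
exact: (@finer_sup_top _ _ (fun b : bool => if b then t1 else t2) false).
Qed.

Lemma join_top_nbhs t1 t2 (x : G) (A : set G) :
  nbhs (x : space (join_top t1 t2)) A <->
  exists B C, [/\ nbhs (x : space t1) B, nbhs (x : space t2) C &
                  B `&` C `<=` A].
Proof.
split; last first.
  move=> [B [C [xB xC BCA]]].
  apply: (@filterS _ _ (nbhs_filter (x : space (join_top t1 t2))) _ _ BCA).
  apply: (@filterI _ _ (nbhs_filter (x : space (join_top t1 t2)))).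
    exact: (finer_nbhs (@finer_joinl t1 t2) xB).
  exact: (finer_nbhs (@finer_joinr t1 t2) xC).
have F1 := nbhs_filter (x : space t1); have F2 := nbhs_filter (x : space t2).
pose F : set_system G := [set A | exists B C, [/\ nbhs (x : space t1) B,
  nbhs (x : space t2) C & B `&` C `<=` A]].
have FF : Filter F.
  split.
  - exists setT, setT; split => //; first exact: (@filterT _ _ F1).
    exact: (@filterT _ _ F2).
  - move=> D E [B1 [C1 [? ? BC1]]] [B2 [C2 [? ? BC2]]].
    exists (B1 `&` B2), (C1 `&` C2).
    split; [exact: (@filterI _ _ F1)|exact: (@filterI _ _ F2)|].
    by move=> y [[? ?] [? ?]]; split; [exact: BC1|exact: BC2].
  - move=> D E DE [B [C [? ? BC]]]; exists B, C; split => //.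
    exact: subset_trans DE.
apply: ((@cvg_sup G bool (fun b => if b then t1 else t2) F x FF).2 _).
move=> [] B xB.
  by exists B, setT; split => //; exact: (@filterT _ _ F2).
by exists setT, B; split => //; exact: (@filterT _ _ F1).
Qed.

Lemma hausdorff_dual_separated t :
  (forall x : G, x <> 0 -> exists f : dual R t, f x <> 0) ->
  hausdorff_space (space t).
Proof.
move=> sep; apply: separated_hausdorff (@circle_hausdorff R) _ => x y xy.
have [|f fxy] := sep (x - y).
  by move/eqP; rewrite subr_eq0 => /eqP.
exists f; first exact: dual_continuous.
by move=> fE; apply: fxy; rewrite raddfB /= fE subrr.
Qed.

Lemma lqc_separated t (x : G) : locally_quasi_convex R t -> x <> 0 ->
  exists f : dual R t, f x <> 0.
Proof.
move=> [th tq] x0.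
have [U U0 Ux] : exists2 U, nbhs (0 : space t) U & ~ U x.
  apply: contrapT => allU; apply: x0; apply/esym/th => A B A0 xB.
  exists x; split; last exact: (@nbhs_singleton (space t) _ _ xB).
  by apply: contrapT => nA; apply: allU; exists A.
have [V [qV V0 VU]] := tq _ U0.
have [f _ fx] := qV x (fun Vx => Ux (VU _ Vx)).
by exists f => fx0; apply: fx; rewrite fx0; exact: circle_pos0.
Qed.

End topologies_and_characters.

(** * Polars as compact quasi-convex sets of characters *)

Section dual_compact.
Variables (R : realType) (G : zmodType) (tau : Topological G).
Local Notation Gd := (dual R tau).

Lemma sigma_eval_continuous (g : G) :
  continuous (fun f : space (sigma_dual R tau) => f g).
Proof.
move=> f.
apply: (@continuous_comp (space (sigma_dual R tau)) {ptws G -> circle R} _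
  (fun f : Gd => (f : G -> circle R)) (fun p => p g)).
  exact: initial_continuous.
exact: (@proj_continuous _ (fun _ : G => circle R : topologicalType) g).
Qed.

Lemma polar_quasi_convex (V : set G) :
  quasi_convex R (sigma_dual R tau) (polar R tau V).
Proof.
move=> f /existsNP[_ /not_implyP[[g Vg <-] fg]].
have evP : (fun f : Gd => f g) \in @hom_pred R Gd by apply/asboolP.
have [F Ff] := @dual_lift R Gd (sigma_dual R tau) (Hom evP)
  (@sigma_eval_continuous g).
exists F; rewrite ?Ff //= => _ [h hV <-]; rewrite Ff /=.
by apply: hV; exists g.
Qed.

(** The polar of [V] is compact for the pointwise topology as soon as the
    homomorphisms that map [V] into the right half-circle are all continuous: it
    is then closed in the product of the circles, being defined by conditions on
    finitely many coordinates at a time. *)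
Lemma polar_compact (V : set G) : alg_polar R V `<=` continuous_char R tau ->
  compact (polar R tau V : set (space (sigma_dual R tau))).
Proof.
move=> Vtau; apply: compact_initial.
have ct := @tychonoff G (fun _ => circle R : topologicalType) (fun _ => setT)
  (fun _ => @circle_compact R).
apply: (subclosed_compact _ ct) => //.
have pc (x : G) : continuous (fun p : {ptws G -> circle R} => p x).
  exact: (@proj_continuous _ (fun _ : G => circle R : topologicalType) x).
have -> : [set (f : {ptws G -> circle R}) | f in polar R tau V] =
  (\bigcap_(xy in [set: G * G])
     (fun p : {ptws G -> circle R} => p (xy.1 + xy.2) - (p xy.1 + p xy.2))
       @^-1` [set 0]) `&`
  \bigcap_(x in V) (fun p : {ptws G -> circle R} => p x) @^-1` circle_pos R.
  rewrite eqEsubset; split=> p.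
    move=> [f fV <-]; split=> [[x y] _|x Vx] /=.
      by rewrite raddfD subrr.
    by apply: fV; exists x.
  move=> [pD pV].
  have pDE x y : p (x + y) = p x + p y.
    by apply/eqP; rewrite -subr_eq0; apply/eqP; exact: (pD (x, y)).
  have p0 : p 0 = 0.
    by apply: (addrI (p 0)); rewrite -pDE !addr0.
  have pP : p \in @hom_pred R G by apply/asboolP.
  have [|F Fp] := @dual_lift R G tau (Hom pP).
    by apply: Vtau => _ [x Vx <-]; exact: pV.
  exists F; last by rewrite Fp.
  by move=> _ [x Vx <-]; rewrite Fp; exact: pV.
apply: closedI; apply: closed_bigI.
  move=> [x y] _ /=; apply: closed_comp => [p _|]; last first.
    apply: accessible_closed_set1.
    exact: hausdorff_accessible (@circle_hausdorff R).
  apply: (@continuous2_cvg {ptws G -> circle R} _ _ _ (nbhs p) _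
    (fun p => p (x + y)) (fun p => p x + p y) (fun a b : circle R => a - b)).
  - exact: (@tvs.sub_continuous (circle R) (p (x + y), p x + p y)).
  - exact: pc.
  apply: (@continuous2_cvg {ptws G -> circle R} _ _ _ (nbhs p) _
    (fun p => p x) (fun p => p y) (fun a b : circle R => a + b)).
  - exact: (@circle_add_continuous R (p x, p y)).
  - exact: pc.
  - exact: pc.
move=> x _; apply: closed_comp => [p _|]; first exact: pc.
exact: closed_circle_pos.
Qed.

End dual_compact.

(** * The family [Mac] and the topologies it defines *)

Section Mac_facts.
Variables (R : realType) (G : zmodType) (tau : Topological G).
Local Notation Gd := (dual R tau).

(** Polars of neighborhoods of [0] for compatible group topologies are in [Mac];
    [V] need not be quasi-convex. *)
Lemma Mac_polar (mu : Topological G) (V : set G) :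
  group_topology mu -> compatible R tau mu -> nbhs (0 : space mu) V ->
  Mac (polar R tau V).
Proof.
move=> mug taumu V0; split; first exact: polar_quasi_convex.
  apply: polar_compact => f fV; rewrite [continuous_char R tau]taumu.
  by apply: (continuous_char_pos mug V0) => g Vg; apply: fV; exists g.
move=> F n finF _ _ f fW; rewrite [continuous_char R tau]taumu.
apply: (@continuous_char_pos _ _ _ mug f
  (prepolar (sumset (nsumset n (polar R tau V)) F))).
  apply: equicontinuous0_prepolar; apply: equicontinuous0_sumset => //.
    apply: equicontinuous0_nsumset => //; apply: (equicontinuous0_pos mug V0).
    by move=> h g hV Vg; apply: hV; exists g.
  by apply: equicontinuous0_finite => //; rewrite [continuous_char R tau]taumu.
by move=> g gW; apply: fW; exists g.
Qed.

Variable K : set Gd.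

Lemma mac_base_prepolar : mac_base K (prepolar K).
Proof.
exists 1%N, [set 0]; split => //.
congr prepolar; rewrite eqEsubset; split=> [f Kf|_ [f Kf [_ -> <-]]].
  by exists f => //; exists 0 => //; rewrite addr0.
by rewrite addr0.
Qed.

Section quasi_convex.
Hypothesis qcK : quasi_convex R (sigma_dual R tau) K.
Local Notation TK := (mac_top qcK).

Lemma prepolar_nbhs_mac_top : nbhs (0 : space TK) (prepolar K).
Proof.
by apply/nbhs0_mac_top; exists (prepolar K) => //; exact: mac_base_prepolar.
Qed.

Lemma mac_top_continuous_char : continuous_char R tau `<=` continuous_char R TK.
Proof.
move=> f /dual_lift[F <-]; apply: continuous_char0; first exact: mac_top_group.
move=> U /circle_pos_small[m mU]; apply/nbhs0_mac_top.
(* the multiples [i * F] with [i <= 2 ^ m] contain all those that the dyadic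
   criterion on the circle asks for *)
pose E : set Gd := [set F *+ i | i in `I_(2 ^ m).+1].
exists (prepolar (sumset (nsumset 1 K) E)).
  exists 1%N, E; split => //; first exact: finite_image.
  by exists 0%N.
move=> g gE; apply: mU => j jm.
have -> : dual_hom F g *+ 2 ^ j = dual_hom (F *+ 2 ^ j) g.
  by elim: (2 ^ j)%N => [//|n IH]; rewrite !mulrS IH.
apply: gE; exists 0; first exact: (quasi_convex0 qcK).
exists (F *+ 2 ^ j); last by rewrite add0r.
by exists (2 ^ j)%N => //=; rewrite ltnS leq_exp2l.
Qed.

Lemma mac_top_lqc : locally_quasi_convex R tau -> locally_quasi_convex R TK.
Proof.
move=> tauq; split.
  apply: (@hausdorff_dual_separated R) => x /(lqc_separated tauq)[f fx].
  have [F Ff] := dual_lift (mac_top_continuous_char (@dual_continuous _ _ _ f)).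
  by exists F; rewrite ?Ff.
move=> U /nbhs0_mac_top[V KV VU]; exists V; split => //.
  move: KV => [n [F [_ _ _ ->]]]; apply: quasi_convexS.
    exact: mac_top_continuous_char.
  exact: quasi_convex_prepolar.
by apply/nbhs0_mac_top; exists V.
Qed.

End quasi_convex.

Lemma Mac_top_compatible (MK : Mac K) : compatible R tau (Mac_top MK).
Proof.
rewrite /compatible eqEsubset; split; first exact: mac_top_continuous_char.
move=> f fc; have [_ _ Kn] := MK.
have := continuous_char_nbhs0 fc (@nbhs_circle_pos R).
move=> /nbhs0_mac_top[_ [n [F [n0 finF F0 ->]]] Vf].
by apply: (Kn F n finF F0 n0) => _ [g gV <-]; exact: Vf.
Qed.

Lemma Mac_top_admissible (MK : Mac K) : locally_quasi_convex R tau ->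
  admissible R tau (Mac_top MK).
Proof.
move=> tauq; split; first exact: mac_top_group.
  exact: mac_top_lqc.
exact: Mac_top_compatible.
Qed.

End Mac_facts.

Lemma Mac_topS (R : realType) (G : zmodType) (tau : Topological G)
    (K1 K2 : set (dual R tau)) (M1 : Mac K1) (M2 : Mac K2) :
  K1 `<=` K2 -> finer (Mac_top M2) (Mac_top M1).
Proof.
move=> K12; apply: finer_nbhs0; [exact: mac_top_group..|].
move=> A /nbhs0_mac_top[_ [n [F [n0 finF F0 ->]]] VA]; apply/nbhs0_mac_top.
exists (prepolar (sumset (nsumset n K2) F)); first by exists n, F.
move=> g gV; apply: VA => f fS; apply: gV; apply: sumsetS fS => //.
rewrite /nsumset; elim: n.-1 => //= k IH; exact: sumsetS.
Qed.

(** * The equivalences *)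

Section equivalence.
Variables (R : realType) (G : zmodType) (tau : Topological G).
Hypothesis tau_group : group_topology tau.
Hypothesis tau_lqc : locally_quasi_convex R tau.
Local Notation Gd := (dual R tau).
Local Notation mackey_top :=
  (sup_top (fun K : {K : set Gd | Mac K} => Mac_top (svalP K))).

Lemma finer_mackey_top (K : {K : set Gd | Mac K}) :
  finer mackey_top (Mac_top (svalP K)).
Proof.
exact: (@finer_sup_top _ _
  (fun K : {K : set Gd | Mac K} => Mac_top (svalP K)) K).
Qed.

Lemma mackey_top_group : group_topology mackey_top.
Proof. by apply: sup_top_group => K; exact: mac_top_group. Qed.

(** A quasi-convex [mu]-neighborhood [V] of [0] is the prepolar of its polar
    [K], hence a neighborhood of [0] for [T_K]. *)
Lemma mackey_top_finest (mu : Topological G) : admissible R tau mu ->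
  finer mackey_top mu.
Proof.
move=> [mug [muh muq] taumu].
apply: finer_nbhs0 => //; first exact: mackey_top_group.
move=> A /muq[V [qV V0 VA]].
have MV := Mac_polar mug taumu V0.
pose K : {K : set Gd | Mac K} := exist _ _ MV.
apply: (@filterS _ _ (nbhs_filter (0 : space mackey_top)) _ _ VA).
apply: (finer_nbhs (@finer_mackey_top K)).
have := prepolar_nbhs_mac_top (Mac_quasi_convex (svalP K)).
apply: (@filterS _ _ (nbhs_filter (0 : space (Mac_top (svalP K))))) => /=.
apply: bipolar_quasi_convex; apply: quasi_convexS qV.
by rewrite [continuous_char R tau]taumu.
Qed.

Lemma Mac_nonempty : exists K : set Gd, Mac K.
Proof.
exists (polar R tau setT); apply: (@Mac_polar R G tau tau) => //.
exact: (@filterT _ _ (nbhs_filter (0 : space tau))).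
Qed.

Lemma directed_is_mackey :
  directed (@Mac R G tau) -> is_mackey R tau mackey_top.
Proof.
move=> dir; have [K0' M0] := Mac_nonempty.
pose K0 : {K : set Gd | Mac K} := exist _ _ M0.
split; last exact: mackey_top_finest.
split; first exact: mackey_top_group.
  by apply: (sup_top_lqc K0) => K; exact: mac_top_lqc.
rewrite /compatible eqEsubset; split.
  rewrite (Mac_top_compatible (svalP K0)); apply: finer_continuous_char.
  exact: (@finer_mackey_top K0).
move=> f fc; have f0 := continuous_char_nbhs0 fc (@nbhs_circle_pos R).
have [|K Kf] := sup_top_directed_nbhs K0 _ f0.
  move=> [K1 M1] [K2 M2]; have [K MK K12] := dir _ _ M1 M2.
  exists (exist _ K MK); split; apply: Mac_topS; move=> h Kh; apply: K12.
    by left.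
  by right.
rewrite (Mac_top_compatible (svalP K)).
by apply: (continuous_char_pos _ Kf) => //; exact: mac_top_group.
Qed.

Lemma has_mackey_directed : has_mackey R tau -> directed (@Mac R G tau).
Proof.
move=> [mu [[mug _ taumu] mufin]] K1 K2 M1 M2.
have nK (K : set Gd) (M : Mac K) : nbhs (0 : space mu) (prepolar K).
  apply: (finer_nbhs (mufin _ (Mac_top_admissible M tau_lqc))).
  exact: prepolar_nbhs_mac_top.
exists (qc_hull (K1 `|` K2)); last exact: subset_qc_hull.
apply: (Mac_polar mug taumu); rewrite prepolarU.
by apply: (@filterI _ _ (nbhs_filter (0 : space mu))); exact: nK.
Qed.

Lemma directed_hull (K1 K2 : set Gd) : directed (@Mac R G tau) ->
  Mac K1 -> Mac K2 -> Mac (qc_hull (K1 `|` K2)).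
Proof.
move=> dir M1 M2; have [K MK K12] := dir _ _ M1 M2.
have KG := mac_top_group (Mac_quasi_convex MK).
apply: (Mac_polar KG (Mac_top_compatible MK)).
have := prepolar_nbhs_mac_top (Mac_quasi_convex MK).
apply: (@filterS _ _ (nbhs_filter (0 : space (Mac_top MK)))).
by move=> g gK f /K12 fK; exact: gK.
Qed.

Lemma hull_join_compatible (K1 K2 : set Gd) (M1 : Mac K1) (M2 : Mac K2) :
  Mac (qc_hull (K1 `|` K2)) ->
  compatible R tau (join_top (Mac_top M1) (Mac_top M2)).
Proof.
move=> M; rewrite /compatible eqEsubset; split.
  rewrite (Mac_top_compatible M1); apply: finer_continuous_char.
  exact: finer_joinl.
rewrite (Mac_top_compatible M); apply: finer_continuous_char.
by apply: sup_top_coarsest => -[]; apply: Mac_topS => f Kf;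
  apply: subset_qc_hull; [left|right].
Qed.

Lemma join_compatible_directed :
  (forall (K1 K2 : set Gd) (M1 : Mac K1) (M2 : Mac K2),
     compatible R tau (join_top (Mac_top M1) (Mac_top M2))) ->
  directed (@Mac R G tau).
Proof.
move=> jc K1 K2 M1 M2; exists (qc_hull (K1 `|` K2)); last exact: subset_qc_hull.
apply: (@Mac_polar _ _ _ (join_top (Mac_top M1) (Mac_top M2))); last 1 first.
- rewrite prepolarU; apply/join_top_nbhs.
  exists (prepolar K1), (prepolar K2).
  by split => //; exact: prepolar_nbhs_mac_top.
- by apply: sup_top_group => -[]; exact: mac_top_group.
- exact: jc.
Qed.

Section diagonal.
Variables t1 t2 : Topological G.
Local Notation t12 := (prod_top t1 t2).

(** A continuous character of the diagonal is a character of the join of [t1]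
    and [t2]; when it is continuous for [t1] alone, composing it with the first
    projection extends it to the product. *)
Lemma join_dually_embedded :
  continuous_char R (join_top t1 t2) `<=` continuous_char R t1 ->
  dually_embedded R t12 (diagonal_group G).
Proof.
move=> jt1 f fD /subspace_continuousP fc.
have inD g : (g, g) \in diagonal_group G by rewrite inE; exists g.
have chiP : (fun g => f (g, g)) \in @hom_pred R G.
  have fDD x y : f (x + y, x + y) = f (x, x) + f (y, y) by rewrite -fD.
  apply/asboolP; split; last exact: fDD.
  by apply: (addrI (f (0, 0))); rewrite -fDD !addr0.
have chic : continuous_char R t1 (Hom chiP).
  apply: jt1 => x A /= xA; apply/join_top_nbhs.
  have [|[B C] [/= xB xC] BCA] := fc (x, x) _ A xA; first by exists x.
  exists B, C; split => // g [Bg Cg].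
  by apply: (BCA (g, g)) => //; exists g.
have extP : (fun x => Hom chiP x.1) \in @hom_pred R (G * G)%type.
  by apply/asboolP; split=> [|x y]; rewrite ?raddf0 ?raddfD.
have [|F Ff] := @dual_lift R (G * G)%type t12 (Hom extP).
  move=> [x y] A /= xA; exists ([set g | A (Hom chiP g)], setT).
    split => /=; first exact: chic.
    exact: (@filterT _ _ (nbhs_filter (y : space t2))).
  by move=> [g h] [].
by exists F => x; rewrite inE => -[g ->]; rewrite Ff.
Qed.

(** Conversely a character of the join lives on the diagonal; the summands are
    the restrictions to the two factors of an extension to the product. *)
Lemma dually_embedded_join : dually_embedded R t12 (diagonal_group G) ->
  forall f, continuous_char R (join_top t1 t2) f ->
  exists f1 f2,
    [/\ continuous_char R t1 f1, continuous_char R t2 f2 & f = f1 + f2].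
Proof.
move=> dual_diag f fc.
have [||chi chiE] := dual_diag (fun x => f x.1).
- by move=> x y _ _; rewrite raddfD.
- apply/subspace_continuousP => _ [g ->] A /= gA.
  have /join_top_nbhs[B [C [gB gC BCA]]] := fc g A gA.
  exists (B, C) => // -[x y] [/= Bx Cy] [h [xh yh]]; apply: BCA.
  by split => //; rewrite xh -yh.
have inD g : (g, g) \in diagonal_group G by rewrite inE; exists g.
have P1 : (fun x => chi (x, 0)) \in @hom_pred R G.
  apply/asboolP; split=> [|x y]; first exact: raddf0.
  by rewrite -raddfD; congr (chi (_, _)); rewrite addr0.
have P2 : (fun x => chi (0, x)) \in @hom_pred R G.
  apply/asboolP; split=> [|x y]; first exact: raddf0.
  by rewrite -raddfD; congr (chi (_, _)); rewrite addr0.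
exists (Hom P1), (Hom P2); split.
- move=> x A /= xA.
  have [[B C] [/= xB C0] BCA] := @dual_continuous _ _ _ chi (x, 0) A xA.
  apply: (@filterS _ _ (nbhs_filter (x : space t1)) _ _ _ xB) => g Bg.
  apply: (BCA (g, 0)); split => //.
  exact: (@nbhs_singleton (space t2) _ _ C0).
- move=> x A /= xA.
  have [[B C] [/= B0 xC] BCA] := @dual_continuous _ _ _ chi (0, x) A xA.
  apply: (@filterS _ _ (nbhs_filter (x : space t2)) _ _ _ xC) => g Cg.
  apply: (BCA (0, g)); split => //.
  exact: (@nbhs_singleton (space t1) _ _ B0).
apply/val_inj/funext => g.
have := chiE _ (inD g); rewrite /= => <-.
transitivity (chi (g, 0) + chi (0, g)) => //.
by rewrite -raddfD; congr (chi (_, _)); rewrite ?addr0 ?add0r.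
Qed.

End diagonal.

Lemma dually_embedded_compatible (K1 K2 : set Gd) (M1 : Mac K1) (M2 : Mac K2) :
  dually_embedded R (prod_top (Mac_top M1) (Mac_top M2)) (diagonal_group G) ->
  compatible R tau (join_top (Mac_top M1) (Mac_top M2)).
Proof.
move=> emb; rewrite /compatible eqEsubset; split.
  rewrite (Mac_top_compatible M1); apply: finer_continuous_char.
  exact: finer_joinl.
move=> f /(dually_embedded_join emb)[f1 [f2 []]].
rewrite -(Mac_top_compatible M1) -(Mac_top_compatible M2).
move=> /dual_lift[F1 <-] /dual_lift[F2 <-] ->.
exact: (@dual_continuous _ _ _ (F1 + F2)).
Qed.

End equivalence.

Theorem theorem3p10 (R : realType) (G : zmodType) (tau : Topological G)
  (tau_group : group_topology tau) (tau_lqc : locally_quasi_convex R tau) :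
  [<-> has_mackey R tau;
       directed (@Mac R G tau);
       forall K1 K2 : set (dual R tau),
         Mac K1 -> Mac K2 -> Mac (qc_hull (K1 `|` K2));
       forall (K1 K2 : set (dual R tau)) (M1 : Mac K1) (M2 : Mac K2),
         compatible R tau (join_top (Mac_top M1) (Mac_top M2));
       forall (K1 K2 : set (dual R tau)) (M1 : Mac K1) (M2 : Mac K2),
         dually_embedded R (prod_top (Mac_top M1) (Mac_top M2))
           (diagonal_group G)]
  /\
  (has_mackey R tau ->
   is_mackey R tau
     (sup_top (fun K : {K : set (dual R tau) | Mac K} => Mac_top (svalP K)))).
Proof.
split; last first.
  move=> /(has_mackey_directed tau_lqc).
  exact: directed_is_mackey.
tfae.
- exact: has_mackey_directed.
- by move=> dir K1 K2; exact: directed_hull.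
- by move=> hull K1 K2 M1 M2; apply: hull_join_compatible; exact: hull.
- move=> jc K1 K2 M1 M2; apply: join_dually_embedded.
  by rewrite -(jc _ _ M1 M2) -(Mac_top_compatible M1).
- move=> emb; exists
    (sup_top (fun K : {K : set (dual R tau) | Mac K} => Mac_top (svalP K))).
  apply: directed_is_mackey => //; apply: join_compatible_directed.
  by move=> K1 K2 M1 M2; apply: dually_embedded_compatible; exact: emb.
Qed.
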